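(* Let $K$ be a field and let $G=K_{p_1,p_2}$ be a complete bipartite graph with vertex set $V=V_1\sqcup V_2$, $|V_i|=p_i$ and $p_1\le p_2$. Let $J$ be the cover ideal of $G$ in the polynomial ring $R$ over $K$ with $|V|$ variables. Then: (1) $v(J^n)=np_1+p_2-2$ for all $n\ge1$. (2) $\operatorname{reg}(R/J^n)-v(J^n)=n(p_2-p_1)-(p_2-p_1)$ for all $n\ge1$, and $v(J)=\operatorname{reg}(R/J)$. (3) If $p_2=p_1$ then $\operatorname{reg}(R/J^n)=v(J^n)$ for all $n\ge1$. (4) If $p_2=p_1+1$ then $\operatorname{reg}(R/J^n)-v(J^n)=n-1$ for all $n\ge1$.
   Context: The complete bipartite graph on $V=V_1\sqcup V_2$ (parts nonempty) has as edges exactly all pairs $(i,j)$ with $i\in V_1$, $j\in V_2$. The cover ideal of a finite simple graph $G$ with vertices $1,\ldots,u$ is $J(G)=\bigcap_{(i,j)\in E(G)}\langle x_i,x_j\rangle\subset R=K[x_1,\ldots,x_u]$, with $R$ standard graded. For a homogeneous ideal $I$ of $R=\bigoplus_n R_n$, the $v$-number is $v(I)=\min\{u:\text{there exist } f\in R_u\text{ and }\mathfrak p\in\operatorname{Ass}(R/I)\text{ with }\mathfrak p=(I:f)\}$. For a finitely generated graded $R$-module $M$ with minimal graded free resolution having $i$-th term $\bigoplus_jR(-j)^{\beta_{ij}}$, the Castelnuovo–Mumford regularity is $\operatorname{reg}(M)=\max\{j-i:\beta_{ij}\ne0\}$. *)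

(* Defs.v *)
From HB Require Import structures.
From mathcomp Require Export all_boot all_order all_algebra.
From mathcomp Require Export boolp.
From mathcomp Require Export mpoly.

Set Implicit Arguments.
Unset Strict Implicit.
Unset Printing Implicit Defensive.

Import GRing.Theory Num.Theory.
Local Open Scope ring_scope.

Record sgraph (u : nat) := SGraph {
  edge : rel 'I_u;
  edge_sym : ssrbool.symmetric edge;
  edge_irrefl : irreflexive edge
}.

Definition complete_bipartite (u : nat) (G : sgraph u) (V1 V2 : {set 'I_u}) : Prop :=
  [/\ V1 != set0, V2 != set0, V1 :|: V2 = [set: 'I_u], [disjoint V1 & V2] &
      forall i j, edge G i j =
        (i \in V1) && (j \in V2) || (i \in V2) && (j \in V1)].

(* Ideals are predicates in {pred R}; those defined by an existential
   statement are made boolean with the classical [`[< _ >]]. *)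
Section Ideals.
Variable R : comNzRingType.
Implicit Types I J : {pred R}.

Definition gen2 (a b : R) : {pred R} :=
  [pred f | `[< exists g h : R, f = g * a + h * b >]].

Definition ideal_mul I J : {pred R} :=
  [pred f | `[< exists2 s : seq (R * R),
                  all (fun p => (p.1 \in I) && (p.2 \in J)) s &
                  f = \sum_(p <- s) p.1 * p.2 >]].

Fixpoint ideal_exp I (n : nat) : {pred R} :=
  if n is m.+1 then ideal_mul I (ideal_exp I m) else predT.

Definition colon I (f : R) : {pred R} := [pred g | g * f \in I].

Definition prime_ideal (P : {pred R}) : Prop :=
  idealr_closed P /\ prime_idealr_closed P.

(* [colon I f] is the annihilator of the class of [f] in [R/I]. *)
Definition associated_prime I (P : {pred R}) : Prop :=
  prime_ideal P /\ exists f : R, P =i colon I f.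

End Ideals.

Section GradedIdeals.
Variables (K : fieldType) (u : nat).
Local Notation R := {mpoly K[u]}.
Implicit Type I : {pred R}.

Definition cover_ideal (G : sgraph u) : {pred R} :=
  [pred f | [forall i, forall j, edge G i j ==> (f \in gen2 'X_i 'X_j)]].

Definition v_attained I (d : nat) : Prop :=
  exists f : R, exists P : {pred R},
    [/\ f \is d.-homog, associated_prime I P & P =i colon I f].

Definition is_v_number I (v : nat) : Prop :=
  v_attained I v /\ forall d, v_attained I d -> (v <= d)%N.

(* [f] lies in [R_z], where [R_z = 0] for [z < 0]. *)
Definition in_degree (z : int) (f : R) : Prop :=
  forall m : 'X_{1..u}, m \in msupp f -> (mdeg m)%:Z = z.

(* A sequence of graded free modules
     F_i = \bigoplus_(k < frank i) R(- fdeg i k)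
   with degree-0 maps F_(i+1) -> F_i and an augmentation F_0 -> R/I.  Elements
   of F_i are row vectors, on which the matrices act from the right; the
   augmentation is given by homogeneous representatives in R of the images of
   the basis elements. *)
Record graded_free_seq := GradedFreeSeq {
  frank : nat -> nat;
  fdeg : forall i, 'I_(frank i) -> int;
  fdiff : forall i, 'M[R]_(frank i.+1, frank i);
  faug : 'cV[R]_(frank 0);
  fdiff_homog : forall i k l, in_degree (@fdeg i.+1 k - @fdeg i l) (fdiff i k l);
  faug_homog : forall k, in_degree (@fdeg 0 k) (faug k 0)
}.

Definition free_resolution I (F : graded_free_seq) : Prop :=
  [/\ forall f : R, exists x : 'rV[R]_(frank F 0), f - (x *m faug F) 0 0 \in I,
      forall x : 'rV[R]_(frank F 0),
        (x *m faug F) 0 0 \in I <-> exists y, x = y *m fdiff F 0 &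
      forall i (x : 'rV[R]_(frank F i.+1)),
        x *m fdiff F i = 0 <-> exists y, x = y *m fdiff F i.+1].

(* All entries of the differentials lie in the ideal (x_1, ..., x_u). *)
Definition minimal (F : graded_free_seq) : Prop :=
  forall i k l, (fdiff F i k l)@_0%MM = 0.

Definition minimal_free_resolution I (F : graded_free_seq) : Prop :=
  free_resolution I F /\ minimal F.

Definition betti (F : graded_free_seq) (i : nat) (j : int) : nat :=
  #|[set k : 'I_(frank F i) | fdeg k == j]|.

(* [reg (R/I) = r].  Quantifying over all minimal resolutions, besides asking
   for one, makes [r] unique without appeal to the uniqueness of the minimal
   resolution up to isomorphism. *)
Definition is_regularity I (r : int) : Prop :=
  (exists F, minimal_free_resolution I F) /\
  forall F, minimal_free_resolution I F ->
    (exists i j, betti F i j != 0%N /\ r = j - i%:Z) /\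
    (forall i j, betti F i j != 0%N -> j - i%:Z <= r).

End GradedIdeals.

Arguments cover_ideal K {u} G.

(* Main.v *)
From mathcomp Require Import zify ring.
Require Import Defs.
Set Implicit Arguments.
Unset Strict Implicit.
Unset Printing Implicit Defensive.
Import GRing.Theory Num.Theory.
Local Open Scope ring_scope.

(** Let [a] and [b] be the products of the variables of [V1] and of [V2].  Then
    [J = (a, b)], and [J^n] is spanned by the monomials [x^m] such that
    [m i + m j >= n] for all [i] in [V1] and [j] in [V2].

    If [P = (J^n : f)] is prime, it contains some [x_i] and [x_j] with [i] in
    [V1] and [j] in [V2].  A monomial [x^m] of [f] outside [J^n] is moved into
    [J^n] by both variables, so [m i + m j = n - 1], while [m k > m i] for the
    other [k] in [V1] and [m k > m j] for the other [k] in [V2]; this bounds the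
    degree from below, and [a^n b / (x_i x_j)] attains the bound.

    As [a], [b] is a regular sequence, the Hilbert-Burch complex
    [0 -> R^n -> R^(n+1) -> R] on the generators [a^(n-i) b^i] is a minimal
    resolution of [R/J^n], of regularity [p1 + n p2 - 2].  Any other minimal
    resolution has the same degrees: graded comparison maps between the two are
    inverse to each other modulo the maximal ideal. *)

(** * Monomial ideals as conditions on the support *)

Section MonomialIdeals.
Variables (R : idomainType) (u : nat).
Implicit Types (C : pred 'X_{1..u}) (m : 'X_{1..u}) (f g : {mpoly R[u]}).

(** This is an ideal only when [C] is stable under adding exponents. Leaving [C] arbitrary lets
    [predT] stand for the whole ring, so that [monomial_idealM] covers both products of ideals and
    absorption. *)
Definition monomial_ideal C : {pred {mpoly R[u]}} := [pred f | all C (msupp f)].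

Lemma monomial_idealP C f :
  reflect {in msupp f, forall m, C m} (f \in monomial_ideal C).
Proof. exact: allP. Qed.

Lemma monomial_idealX C m : ('X_[m] \in monomial_ideal C) = C m.
Proof. by rewrite inE msuppX /= andbT. Qed.

Lemma monomial_idealMX C f m :
  (f * 'X_[m] \in monomial_ideal C) = all (fun k => C (k + m)%MM) (msupp f).
Proof.
rewrite inE (perm_all _ (msuppMX f m)) all_map.
by apply: eq_all => k /=; rewrite addmC.
Qed.

Lemma monomial_ideal0 C : 0 \in monomial_ideal C.
Proof. by rewrite inE msupp0. Qed.

Lemma monomial_idealD C : {in monomial_ideal C &, forall f g, f + g \in monomial_ideal C}.
Proof.
move=> f g /monomial_idealP Cf /monomial_idealP Cg; apply/monomial_idealP => m.
by move/msuppD_le; rewrite mem_cat => /orP[/Cf|/Cg].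
Qed.

Lemma monomial_ideal_sum C (I : eqType) (s : seq I) (F : I -> {mpoly R[u]}) :
  {in s, forall i, F i \in monomial_ideal C} ->
  \sum_(i <- s) F i \in monomial_ideal C.
Proof.
move=> CF; rewrite big_seq; elim/big_ind: _ => //.
  exact: monomial_ideal0.
exact: monomial_idealD.
Qed.

Lemma monomial_idealM C C1 C2 :
    (forall m1 m2, C1 m1 -> C2 m2 -> C (m1 + m2)%MM) ->
  forall f g, f \in monomial_ideal C1 -> g \in monomial_ideal C2 ->
  f * g \in monomial_ideal C.
Proof.
move=> CM f g /monomial_idealP C1f /monomial_idealP C2g.
apply/monomial_idealP => m /msuppM_le /allpairsP[[m1 m2] /= [/C1f ? /C2g ? ->]].
exact: CM.
Qed.

Lemma monomial_ideal_lin C (upC : forall m m', C m' -> C (m + m')%MM) a :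
  {in monomial_ideal C &, forall f g, a * f + g \in monomial_ideal C}.
Proof.
move=> f g Cf Cg; apply: monomial_idealD => //.
apply: (@monomial_idealM C predT C) => //; last exact/allP.
by move=> *; exact: upC.
Qed.

Lemma mpolyX_dvd m f :
  {in msupp f, forall k, (m <= k)%MM} -> exists g, f = g * 'X_[m].
Proof.
move=> le_mf; exists (\sum_(k <- msupp f) f@_k *: 'X_[k - m]).
rewrite {1}[f]mpolyE mulr_suml !big_seq; apply: eq_bigr => k /le_mf le_mk.
by rewrite -scalerAl -mpolyXD submK.
Qed.

Section VariablePrime.
Variable S : {set 'I_u}.

(* Setting the variables of S to 0 is an endomorphism whose kernel is the ideal
   generated by these variables. *)
Definition kill_vars : u.-tuple {mpoly R[u]} :=
  [tuple if i \in S then 0 else 'X_i | i < u].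

Lemma mcoeff_kill_vars f m :
  (f \mPo kill_vars)@_m = if [exists i in S, m i != 0%N] then 0 else f@_m.
Proof.
rewrite comp_mpolyEX raddf_sum /=.
have E k : ('X_[k] \mPo kill_vars)@_m =
    if [exists i in S, m i != 0%N] then 0 else 'X_[R, k]@_m.
  rewrite comp_mpolyX.
  have [/exists_inP[i iS ki]|/exists_inPn kS] := boolP [exists i in S, k i != 0%N].
    rewrite (bigD1 i) //= tnth_mktuple iS expr0n (negPf ki) mul0r mcoeff0.
    rewrite mcoeffX; case: eqP => [<-|_]; last by case: ifP.
    by rewrite ifT //; apply/exists_inP; exists i.
  rewrite (_ : \prod_(i < u) _ = 'X_[k]).
    rewrite mcoeffX; case: eqP => [<-|_]; last by case: ifP.
    by rewrite ifN //; apply/exists_inPn.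
  rewrite mpolyXE_id; apply: eq_bigr => i _; rewrite tnth_mktuple.
  by case: ifP => // /kS; rewrite negbK => /eqP->; rewrite !expr0.
under eq_bigr do rewrite mcoeffZ E.
case: ifP => _; first by rewrite big1 // => k _; rewrite mulr0.
by rewrite [in RHS](mpolyE f) raddf_sum; apply: eq_bigr => k _; rewrite /= mcoeffZ.
Qed.

Lemma mem_variable_ideal f :
  (f \in monomial_ideal (fun m => [exists i in S, m i != 0%N])) =
  (f \mPo kill_vars == 0).
Proof.
apply/monomial_idealP/eqP => [Sf|f0 m].
  apply/mpolyP => m; rewrite mcoeff_kill_vars mcoeff0.
  by case: ifPn => // /negP nSm; apply/memN_msupp_eq0/negP => /Sf.
rewrite mcoeff_msupp; apply: contra_neqT => nSm.
by have := mcoeff_kill_vars f m; rewrite f0 mcoeff0 (negPf nSm).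
Qed.

(** By [mem_variable_ideal] it is the kernel of an endomorphism of a domain. *)
Lemma variable_ideal_prime :
  prime_ideal (monomial_ideal (fun m => [exists i in S, m i != 0%N])).
Proof.
split; last first.
  by move=> f g; rewrite !mem_variable_ideal rmorphM mulf_eq0.
split.
- exact: monomial_ideal0.
- by rewrite mem_variable_ideal rmorph1 oner_eq0.
- move=> a f g; rewrite !mem_variable_ideal => /eqP f0 /eqP g0.
  by rewrite rmorphD rmorphM /= f0 g0 mulr0 addr0.
Qed.
End VariablePrime.
End MonomialIdeals.

(** A monomial with [m i + m j > 0] is a multiple of ['X_i] or of ['X_j]. The sum form matches
    [cover_monomial] for [n = 1]. *)
Lemma mem_gen2X (K : fieldType) (u : nat) (i j : 'I_u) (f : {mpoly K[u]}) :
  (f \in gen2 'X_i 'X_j) = (f \in monomial_ideal (fun m => 0 < m i + m j)%N).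
Proof.
apply/asboolP/monomial_idealP => [[g [h ->]] m|Cf].
  move=> /msuppD_le; rewrite mem_cat !(perm_mem (msuppMX _ _)).
  by case/orP=> /mapP[k _ ->]; rewrite !mnmDE !mnm1E eqxx; lia.
rewrite [f]mpolyE; elim/big_rec: _ => [|m f' _ [g [h ->]]].
  by exists 0, 0; rewrite !mul0r addr0.
have [m0|] := boolP (m \in msupp f); last first.
  by move/memN_msupp_eq0->; exists g, h; rewrite scale0r add0r.
have XU k : m k != 0%N -> 'X_[m] = 'X_[m - U_(k)] * 'X_k :> {mpoly K[u]}.
  move=> mk; rewrite -mpolyXD submK //; apply/mnm_lepP => l; rewrite mnm1E.
  by case: eqP => // <-; rewrite lt0n.
have [mi0|/XU->] := eqVneq (m i) 0%N.
  have /XU-> : m j != 0%N by have := Cf m m0; rewrite mi0 lt0n.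
  exists g, (f@_m *: 'X_[m - U_(j)] + h).
  by rewrite mulrDl -scalerAl addrCA.
exists (f@_m *: 'X_[m - U_(i)] + g), h.
by rewrite mulrDl -scalerAl addrA.
Qed.

(** * Powers of the cover ideal *)

Section CoverMonomials.
Variables (u : nat) (V1 V2 : {set 'I_u}).
Implicit Types m : 'X_{1..u}.

(** These monomials span the intersection of the ideals [(x_i, x_j)^n] over the edges, that is, the
    [n]-th symbolic power of the cover ideal. *)
Definition cover_monomial (n : nat) : pred 'X_{1..u} :=
  fun m => [forall i in V1, forall j in V2, (n <= m i + m j)%N].

Lemma cover_monomialP n m :
  reflect {in V1 & V2, forall i j, (n <= m i + m j)%N} (cover_monomial n m).
Proof.
apply: (iffP forall_inP) => [cm i j /cm/forall_inP|cm i iV]; first exact.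
by apply/forall_inP => j; apply: cm.
Qed.

Lemma cover_monomialD n1 n2 m1 m2 : cover_monomial n1 m1 ->
  cover_monomial n2 m2 -> cover_monomial (n1 + n2) (m1 + m2)%MM.
Proof.
move=> /cover_monomialP c1 /cover_monomialP c2; apply/cover_monomialP => i j iV jV.
by have := c1 i j iV jV; have := c2 i j iV jV; rewrite !mnmDE; lia.
Qed.

Lemma cover_monomial_up n m m' : cover_monomial n m' -> cover_monomial n (m + m')%MM.
Proof. by apply: (@cover_monomialD 0%N n); apply/cover_monomialP. Qed.

Hypothesis V12 : [disjoint V1 & V2].
Local Notation A := (mesym1 V1).
Local Notation B := (mesym1 V2).

(** If [m] is positive on all of [V1], then [A] can be removed, and each [m i + m j] drops by
    exactly one. Otherwise [m i = 0] for some [i] in [V1], which forces [m j > n] on all of [V2], so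
    that [B] can be removed. *)
Lemma cover_monomial_step n m : cover_monomial n.+1 m ->
  (A <= m)%MM && cover_monomial n (m - A)%MM \/ (B <= m)%MM && cover_monomial n (m - B)%MM.
Proof.
move=> /cover_monomialP cm.
have [/forall_inP m1|] := boolP [forall i in V1, m i != 0%N].
  left; apply/andP; split.
    by apply/mnm_lepP => i; rewrite mnmE; case: (boolP (i \in V1)) => // /m1; rewrite lt0n.
  apply/cover_monomialP => i j iV jV; have := cm _ _ iV jV.
  rewrite !mnmBE !mnmE iV (disjointFl V12 jV); lia.
case/forall_inPn => i iV; rewrite negbK => /eqP mi0; right.
have mj j : j \in V2 -> (n < m j)%N by move=> jV; have := cm _ _ iV jV; rewrite mi0.
apply/andP; split.
  by apply/mnm_lepP => j; rewrite mnmE; case: (boolP (j \in V2)) => // /mj; apply: leq_trans.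
apply/cover_monomialP => i' j _ /[dup] jV /mj; rewrite !mnmBE !mnmE jV; lia.
Qed.

Lemma cover_monomial_dvd n m : cover_monomial n m ->
  exists i : 'I_n.+1, (A *+ (n - i) + B *+ i <= m)%MM.
Proof.
elim: n m => [|n IHn] m.
  by move=> _; exists ord0; rewrite !mulm0n addm0; apply/mnm_lepP => i; rewrite mnm0E.
case/cover_monomial_step => /andP[leC /IHn[i /mnm_lepP le_i]].
  exists (widen_ord (leqnSn _) i); apply/mnm_lepP => k.
  have := le_i k; move/mnm_lepP/(_ k): leC.
  by rewrite !mnmDE !mnmBE !mulmnE /= subSn ?mulnS -1?ltnS //; lia.
exists (lift ord0 i); apply/mnm_lepP => k.
have := le_i k; move/mnm_lepP/(_ k): leC.
rewrite !mnmDE !mnmBE !mulmnE.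
by rewrite (_ : nat_of_ord (lift ord0 i) = i.+1) // mulnS; lia.
Qed.

Lemma cover_monomial_gens n i : (i <= n)%N -> cover_monomial n (A *+ (n - i) + B *+ i)%MM.
Proof.
move=> le_in; apply/cover_monomialP => j k jV kV.
by rewrite !mnmDE !mulmnE !mnmE jV kV (disjointFl V12 kV) (disjointFr V12 jV); lia.
Qed.

Section Polynomials.
Variables (K : fieldType) (G : sgraph u).
Hypothesis HG : complete_bipartite G V1 V2.
Local Notation R := {mpoly K[u]}.

Lemma mem_cover_ideal (f : R) :
  (f \in cover_ideal K G) = (f \in monomial_ideal (cover_monomial 1)).
Proof.
case: HG => _ _ _ _ edgeE.
apply/forallP/monomial_idealP => [Jf m mf|Cf i].
  apply/cover_monomialP => i j iV jV.
  have := forallP (Jf i) j; rewrite edgeE iV jV /= mem_gen2X.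
  by move/monomial_idealP; apply.
apply/forallP => j; apply/implyP; rewrite edgeE mem_gen2X => eij.
apply/monomial_idealP => m /Cf/cover_monomialP Cm.
by case/orP: eij => /andP[iV jV]; [|rewrite addnC]; apply: Cm.
Qed.

(** One inclusion holds because the bounds on exponents add up under products. For the other,
    [cover_monomial_step] splits a factor ['X_[A]] or ['X_[B]] off each monomial. *)
Lemma mem_cover_ideal_exp n (f : R) :
  (f \in ideal_exp (cover_ideal K G) n) = (f \in monomial_ideal (cover_monomial n)).
Proof.
elim: n f => [|n IHn] f.
  by apply/esym/allP => m _; apply/cover_monomialP.
apply/asboolP/monomial_idealP => [[s /allP s_in ->]|Cf].
  apply/monomial_idealP/monomial_ideal_sum => p /s_in/andP[p1 p2].
  rewrite IHn in p2; rewrite mem_cover_ideal in p1.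
  exact: monomial_idealM (@cover_monomialD 1 n) _ _ p1 p2.
have genJ : 'X_[A] \in cover_ideal K G /\ 'X_[B] \in cover_ideal K G.
  rewrite !mem_cover_ideal !monomial_idealX.
  by split; apply/cover_monomialP => i j iV jV; rewrite !mnmE ?iV ?jV // addnC.
rewrite [f]mpolyE big_seq; elim/big_rec: _ => [|m f' /Cf cm [s s_in ->]].
  by exists [::]; rewrite ?big_nil.
have split_term (C : 'X_{1..u}) : 'X_[C] \in cover_ideal K G ->
    (C <= m)%MM && cover_monomial n (m - C)%MM ->
    exists2 s0 : seq (R * R),
      all (fun p => (p.1 \in cover_ideal K G) &&
                    (p.2 \in ideal_exp (cover_ideal K G) n)) s0 &
      f@_m *: 'X_[m] + \sum_(p <- s) p.1 * p.2 = \sum_(p <- s0) p.1 * p.2.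
  move=> CJ /andP[leC cC]; exists (('X_[C], f@_m *: 'X_[m - C]) :: s).
    rewrite /= CJ IHn s_in andbT -mul_mpolyC.
    apply: (@monomial_idealM _ _ _ predT (cover_monomial n)).
    + by move=> *; apply: cover_monomial_up.
    + exact/allP.
    + by rewrite monomial_idealX.
  by rewrite big_cons /= -scalerAr -mpolyXD addmC submK.
by case/cover_monomial_step: cm; apply: split_term; case: genJ.
Qed.

End Polynomials.
End CoverMonomials.

(** * The v-number *)

Lemma prime_ideal_exp (R : idomainType) (P : {pred R}) x e :
  prime_ideal P -> x ^+ e \in P -> (e != 0%N) && (x \in P).
Proof.
case=> -[_ n1P _] mulP; elim: e => [|e IHe]; first by rewrite expr0 (negPf n1P).
by rewrite exprS => /mulP/orP[//|/IHe/andP[]].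
Qed.

Lemma prime_idealX (R : idomainType) (u : nat) (P : {pred {mpoly R[u]}}) (m : 'X_{1..u}) :
  prime_ideal P -> 'X_[m] \in P -> exists2 i, m i != 0%N & 'X_i \in P.
Proof.
move=> pP; rewrite mpolyXE_id; have [[_ n1P _] mulP] := pP.
elim/big_rec: _ => [|i f _ IH /mulP/orP[|/IH//]]; first by rewrite (negPf n1P).
by case/(prime_ideal_exp pP)/andP=> ? ?; exists i.
Qed.

(** All terms but [F i] are at least [(F i).+1]; the successor on the right makes up for the single
    term that falls short by one. *)
Lemma sum_over_unique_min (T : finType) (S : {set T}) (F : T -> nat) i :
  i \in S -> {in S, forall k, k != i -> (F i < F k)%N} ->
  (#|S| * (F i).+1 <= (\sum_(k in S) F k).+1)%N.
Proof.
move=> iS Fi; rewrite -sum_nat_const (bigD1 i) //= [X in (_ <= X.+1)%N](bigD1 i) //=.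
by rewrite addSn ltnS leq_add2l; apply: leq_sum => k /andP[kS /(Fi k kS)].
Qed.

Section VNumber.
Variables (K : fieldType) (u : nat) (G : sgraph u) (V1 V2 : {set 'I_u}).
Hypothesis HG : complete_bipartite G V1 V2.
Local Notation R := {mpoly K[u]}.
Local Notation J := (cover_ideal K G).

Lemma cover_v_attained n : (0 < n)%N ->
  v_attained (ideal_exp J n) (n * #|V1| + #|V2| - 2)%N.
Proof.
case: (HG) => /set0Pn[i iV] /set0Pn[j jV] _ V12 _ n_gt0.
pose m0 : 'X_{1..u} := (mesym1 V1 *+ n + mesym1 V2)%MM.
have V12F k : k \in V1 -> k \in V2 = false by exact: disjointFr.
have V21F k : k \in V2 -> k \in V1 = false by exact: disjointFl.
have neqV k l : k \in V1 -> l \in V2 -> k == l = false.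
  by move=> kV lV; apply: contraTF lV => /eqP <-; rewrite V12F.
have U_le : (U_(i) + U_(j) <= m0)%MM.
  apply/mnm_lepP => k; rewrite !mnmDE !mnm1E mulmnE !mnmE.
  have [<-|ik] := eqVneq i k; first by rewrite eq_sym (neqV i j) // iV mul1n; lia.
  by have [<-|_] := eqVneq j k; rewrite ?jV; lia.
pose m := (m0 - (U_(i) + U_(j)))%MM.
(* The sum [m i' + m j'] is [n + 1], less one if [i' = i] and less one if [j' = j]. So only the pair
   [(i, j)] misses [n], and by one: a monomial repairs this exactly when it contains ['X_i] or
   ['X_j]. *)
have colonE : monomial_ideal (fun k => [exists l in [set i; j], k l != 0%N]) =i
    colon (ideal_exp J n) 'X_[K, m].
  move=> g; rewrite [RHS]inE (mem_cover_ideal_exp V12 HG) monomial_idealMX inE.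
  apply: eq_all => k; apply/exists_inP/cover_monomialP => [[l] | Ck].
    rewrite !inE => lij kl i' j' i'V j'V; rewrite !mnmDE !mnmBE !mnmDE !mnm1E.
    rewrite !mulmnE !mnmE i'V j'V (V12F i') // (V21F j') // (neqV i j') //.
    rewrite [j == i']eq_sym (neqV i' j) //.
    have [ii'|_] := eqVneq i i'; have [jj'|_] := eqVneq j j'; try lia.
    by subst i' j'; case/orP: lij => /eqP ll; subst l; lia.
  have := Ck i j iV jV; rewrite !mnmDE !mnmBE !mnmDE !mnm1E.
  rewrite !mulmnE !mnmE iV jV (V12F i) // (V21F j) // !eqxx [j == i]eq_sym neqV //.
  have [ki|ki _] := eqVneq (k i) 0%N; last by exists i; rewrite ?inE ?eqxx.
  by rewrite ki => Cij; exists j; rewrite ?inE ?eqxx ?orbT //; lia.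
exists 'X_[m], (monomial_ideal (fun k => [exists l in [set i; j], k l != 0%N])).
split=> //; last by split; [exact: variable_ideal_prime | exists 'X_[m]].
rewrite dhomogX; apply/eqP; have := congr1 mdeg (submK U_le).
by rewrite !mdegD !mdeg1 mdegMn !mdeg_mesym1 -/m /=; lia.
Qed.

Lemma cover_v_min n d : (#|V1| <= #|V2|)%N ->
  v_attained (ideal_exp J n) d -> (n * #|V1| + #|V2| - 2 <= d)%N.
Proof.
case: (HG) => _ _ V12U V12 _ leV [f [P [f_homog [pP _] PE]]].
(* [P] contains [J^n], hence the [n]-th powers of ['X_[mesym1 V1]] and ['X_[mesym1 V2]]; primality
   then yields a variable from each part. *)
have genP i : (i <= n)%N -> 'X_[mesym1 V1 *+ (n - i) + mesym1 V2 *+ i] \in P.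
  move=> le_in; rewrite PE inE (mem_cover_ideal_exp V12 HG).
  rewrite mulrC monomial_idealMX; apply/allP => m _ /=.
  by apply: cover_monomial_up; apply: (cover_monomial_gens V12 le_in).
have [i iV iP] : exists2 i, i \in V1 & 'X_i \in P.
  have [//|i mi iP] := prime_idealX pP (genP 0%N _); exists i => //.
  by move: mi; rewrite mulm0n addm0 mulmnE mnmE; case: (i \in V1).
have [j jV jP] : exists2 j, j \in V2 & 'X_j \in P.
  have [//|j mj jP] := prime_idealX pP (genP n _); exists j => //.
  by move: mj; rewrite subnn mulm0n add0m mulmnE mnmE; case: (j \in V2).
have : f \notin ideal_exp J n.
  by have [[_ + _] _] := pP; rewrite PE inE mul1r.
rewrite (mem_cover_ideal_exp V12 HG) => /allPn[m mf nCm].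
(* Multiplication by a variable only shifts the support, so the condition applies to the monomial
   [m] of [f] by itself. *)
have mulC k : 'X_k \in P -> cover_monomial V1 V2 n (m + U_(k))%MM.
  rewrite PE inE (mem_cover_ideal_exp V12 HG) mulrC monomial_idealMX.
  by move/allP/(_ m mf).
have [/cover_monomialP Ci /cover_monomialP Cj] := (mulC i iP, mulC j jP).
(* Multiplying by ['X_i] does not change the sum of a pair that avoids [i], so such a pair meets the
   bound already; likewise for [j]. Only [(i, j)] can fail. *)
have Vi i' j' : i' \in V1 -> j' \in V2 -> i' != i -> (n <= m i' + m j')%N.
  move=> i'V j'V; rewrite eq_sym => /negPf ii'; have := Ci i' j' i'V j'V.
  rewrite !mnmDE !mnm1E ii'.
  by case: eqP => [ij'|_]; [rewrite -ij' (disjointFr V12 iV) in j'V | lia].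
have Vj i' j' : i' \in V1 -> j' \in V2 -> j' != j -> (n <= m i' + m j')%N.
  move=> i'V j'V; rewrite eq_sym => /negPf jj'; have := Cj i' j' i'V j'V.
  rewrite !mnmDE !mnm1E jj'.
  by case: eqP => [ji'|_]; [rewrite -ji' (disjointFl V12 jV) in i'V | lia].
have lt_n : (m i + m j < n)%N.
  rewrite ltnNge; apply: contra nCm => Cm; apply/cover_monomialP => i' j' i'V j'V.
  have [->|] := eqVneq i' i; last exact: Vi.
  by have [->//|] := eqVneq j' j; exact: Vj.
have eq_n : (m i + m j).+1 = n.
  have := Ci i j iV jV; rewrite !mnmDE !mnm1E eqxx.
  by case: eqP => [ij|_]; [rewrite -ij (disjointFr V12 iV) in jV | lia].
(* From [m k + m j >= n > m i + m j], the value [m i] is the strict minimum of [m] on [V1]; [m j] is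
   that on [V2] by symmetry. *)
have deg1 : (#|V1| * (m i).+1 <= (\sum_(k in V1) m k).+1)%N.
  by apply: sum_over_unique_min => // k kV ki; have := Vi k j kV jV ki; lia.
have deg2 : (#|V2| * (m j).+1 <= (\sum_(k in V2) m k).+1)%N.
  by apply: sum_over_unique_min => // k kV kj; have := Vj i k iV kV kj; lia.
have dE : d = (\sum_(k in V1) m k + \sum_(k in V2) m k)%N.
  have <- : mdeg m = d := dhomog_mf f_homog mf.
  rewrite mdegE -bigU //=; apply: eq_bigl => k.
  by rewrite !inE -in_setU V12U inE.
(* Adding the bounds gives [d + 2 >= #|V1| (m i + 1) + #|V2| (m j + 1)]. As [m i + 1 = n - m j], the
   right side is [n #|V1| + #|V2| + m j (#|V2| - #|V1|)], whose last term is nonnegative. *)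
by rewrite dE; nia.
Qed.

Lemma cover_v_number n : (0 < n)%N -> (#|V1| <= #|V2|)%N ->
  is_v_number (ideal_exp J n) (n * #|V1| + #|V2| - 2)%N.
Proof.
by move=> n0 leV; split; [exact: cover_v_attained | move=> d; exact: cover_v_min].
Qed.
End VNumber.

(** * Homogeneous components and graded matrices *)

Section HomogeneousComponents.
Variables (K : fieldType) (u : nat).
Local Notation R := {mpoly K[u]}.
Implicit Types (f g : R) (z w : int).

Definition hcomp z f : R := \sum_(m <- msupp f | (mdeg m)%:Z == z) f@_m *: 'X_[m].

Lemma mcoeff_hcomp z f m : (hcomp z f)@_m = if (mdeg m)%:Z == z then f@_m else 0.
Proof.
rewrite /hcomp big_mkcond raddf_sum /=.
have E k : (if (mdeg k)%:Z == z then f@_k *: 'X_[k] else 0 : R)@_m =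
    if (mdeg m)%:Z == z then (f@_k *: 'X_[k])@_m else 0.
  have [->|/eqP km] := eqVneq k m; first by case: ifP; rewrite ?mcoeff0.
  rewrite [in RHS]mcoeffZ mcoeffX (introF eqP km) mulr0 if_same.
  by case: ifP; rewrite ?mcoeff0 // mcoeffZ mcoeffX (introF eqP km) mulr0.
under eq_bigr do rewrite E.
case: ifP => _; last by rewrite big1.
by rewrite [in RHS](mpolyE f) raddf_sum.
Qed.

Lemma hcompD z f g : hcomp z (f + g) = hcomp z f + hcomp z g.
Proof.
by apply/mpolyP => m; rewrite mcoeffD !mcoeff_hcomp mcoeffD; case: ifP; rewrite ?addr0.
Qed.

Lemma hcompB z f g : hcomp z (f - g) = hcomp z f - hcomp z g.
Proof.
by apply/mpolyP => m; rewrite mcoeffB !mcoeff_hcomp mcoeffB; case: ifP; rewrite ?subr0.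
Qed.

Lemma hcomp0 z : hcomp z 0 = 0.
Proof. by apply/mpolyP => m; rewrite mcoeff_hcomp mcoeff0 if_same. Qed.

Lemma hcomp_sum z (I : Type) (s : seq I) (F : I -> R) :
  hcomp z (\sum_(i <- s) F i) = \sum_(i <- s) hcomp z (F i).
Proof. exact: (big_morph _ (hcompD z) (hcomp0 z)). Qed.

Lemma hcomp_monomial z (c : K) (m : 'X_{1..u}) :
  hcomp z (c *: 'X_[m]) = if (mdeg m)%:Z == z then c *: 'X_[m] else 0.
Proof.
apply/mpolyP => k; rewrite mcoeff_hcomp [RHS](fun_if (mcoeff k)) mcoeff0.
rewrite !mcoeffZ !mcoeffX.
by have [->//|_] := eqVneq m k; rewrite mulr0 !if_same.
Qed.

Lemma in_degree_hcomp z f : in_degree z (hcomp z f).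
Proof.
move=> m; rewrite mcoeff_msupp mcoeff_hcomp.
by have [//|] := eqVneq (Posz (mdeg m)) z; rewrite eqxx.
Qed.

Lemma hcomp_id z f : in_degree z f -> hcomp z f = f.
Proof.
move=> fz; apply/mpolyP => m; rewrite mcoeff_hcomp.
case: eqP => // mz; apply/esym/memN_msupp_eq0; apply: contra_notN mz => mf.
exact: fz.
Qed.

Lemma hcompM z w f g : in_degree w g -> hcomp z (f * g) = hcomp (z - w) f * g.
Proof.
move=> gw; rewrite [in LHS](mpolyE f) [in RHS](mpolyE f).
rewrite mulr_suml !hcomp_sum mulr_suml; apply: eq_bigr => k _.
rewrite [in LHS](mpolyE g) [in RHS](mpolyE g).
rewrite !mulr_sumr !hcomp_sum !big_seq; apply: eq_bigr => l /gw lw.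
rewrite hcomp_monomial -scalerAl -scalerAr -mpolyXD scalerA hcomp_monomial.
rewrite mdegD PoszD lw -[_ == z - w](inj_eq (addIr w)) subrK.
case: ifP; last by rewrite mul0r.
by rewrite -scalerAl -scalerAr -mpolyXD scalerA.
Qed.

(** The degree-0 part of a map between free modules with shifts [e] and [d]. Components are indexed
    by integers because a difference of shifts may be negative. *)
Definition hcompmx p q (e : 'I_p -> int) (d : 'I_q -> int) (M : 'M[R]_(p, q)) :=
  \matrix_(k, l) hcomp (e k - d l) (M k l).

Definition homogmx p q (e : 'I_p -> int) (d : 'I_q -> int) (M : 'M[R]_(p, q)) :=
  forall k l, in_degree (e k - d l) (M k l).

Lemma homogmx_hcomp p q (e : 'I_p -> int) (d : 'I_q -> int) M : homogmx e d (hcompmx e d M).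
Proof. by move=> k l; rewrite mxE; apply: in_degree_hcomp. Qed.

Lemma hcompmx_id p q (e : 'I_p -> int) (d : 'I_q -> int) M :
  homogmx e d M -> hcompmx e d M = M.
Proof. by move=> Mh; apply/matrixP => k l; rewrite mxE hcomp_id. Qed.

(** Turns any factorization of a graded matrix through a graded [N] into one whose left factor is
    graded too. *)
Lemma hcompmxM p q r (e : 'I_p -> int) (d : 'I_q -> int) (c : 'I_r -> int) M N :
  homogmx d c N -> hcompmx e c (M *m N) = hcompmx e d M *m N.
Proof.
move=> Nh; apply/matrixP => k l; rewrite !mxE hcomp_sum; apply: eq_bigr => i _.
by rewrite (hcompM _ _ (Nh i l)) !mxE opprB addrA subrK.
Qed.

Lemma hcompmxB p q (e : 'I_p -> int) (d : 'I_q -> int) M N :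
  hcompmx e d (M - N) = hcompmx e d M - hcompmx e d N.
Proof. by apply/matrixP => k l; rewrite !mxE hcompB. Qed.
End HomogeneousComponents.

Lemma mulmx_rowwise (R : pzRingType) p q r (M : 'M[R]_(p, q)) (D : 'M_(r, q)) :
  (forall k, exists y, row k M = y *m D) -> exists Y, M = Y *m D.
Proof.
case/fin_all_exists => Y MY; exists (\matrix_k Y k).
by apply/row_matrixP => k; rewrite row_mul rowK.
Qed.

(** * Comparison of graded resolutions *)

Section Comparison.
Variables (K : fieldType) (u : nat).
Local Notation R := {mpoly K[u]}.
Variable I : {pred R}.
Hypothesis I0 : 0 \in I.
Hypothesis I_lin : forall a : R, {in I &, forall f g, a * f + g \in I}.
Hypothesis I_homog : forall z f, f \in I -> hcomp z f \in I.
Local Notation vanishes M := (forall k l, M k l \in I).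

Let ID : {in I &, forall f g, f + g \in I}.
Proof. by move=> f g If Ig; rewrite -[f]mul1r; apply: I_lin. Qed.

Let IM a f : f \in I -> a * f \in I.
Proof. by move=> If; rewrite -[_ * _]addr0; apply: I_lin. Qed.

Lemma vanishes_mulmx p q r (M : 'M[R]_(p, q)) (N : 'M_(q, r)) :
  vanishes N -> vanishes (M *m N).
Proof.
move=> NI k l; rewrite mxE; elim/big_ind: _ => //.
by move=> i _; apply: IM.
Qed.

Lemma vanishesD p q (M N : 'M[R]_(p, q)) : vanishes M -> vanishes N -> vanishes (M + N).
Proof. by move=> MI NI k l; rewrite mxE; apply: ID. Qed.

Lemma vanishesN p q (M : 'M[R]_(p, q)) : vanishes M -> vanishes (- M).
Proof. by move=> MI k l; rewrite mxE -mulN1r; apply: IM. Qed.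

Section Resolution.
Variable F : graded_free_seq K u.
Hypothesis FI : free_resolution I F.

Lemma resolution_aug p (M : 'cV[R]_p) : exists X, vanishes (M - X *m faug F).
Proof.
case: FI => aug _ _; have [X MX] := fin_all_exists (fun k => aug (M k 0)).
exists (\matrix_k X k) => k l; rewrite ord1 !mxE.
by have := MX k; rewrite !mxE; under [in X in _ -> X]eq_bigr do rewrite mxE.
Qed.

Lemma resolution_aug_ker p (M : 'M[R]_(p, frank F 0)) :
  vanishes (M *m faug F) -> exists Y, M = Y *m fdiff F 0.
Proof.
case: FI => _ ker _ MI; apply: mulmx_rowwise => k; apply/ker.
by rewrite -row_mul mxE.
Qed.

Lemma resolution_aug_diff : vanishes (fdiff F 0 *m faug F).
Proof.
case: FI => _ ker _ k l; rewrite ord1.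
have /ker : exists y, row k (fdiff F 0) = y *m fdiff F 0.
  by exists (delta_mx 0 k); rewrite rowE.
by rewrite -row_mul mxE.
Qed.

Lemma resolution_ker i p (M : 'M[R]_(p, frank F i.+1)) :
  M *m fdiff F i = 0 -> exists Y, M = Y *m fdiff F i.+1.
Proof.
case: FI => _ _ ker M0; apply: mulmx_rowwise => k; apply/ker.
by rewrite -row_mul M0 row0.
Qed.

Lemma resolution_diff_diff i : fdiff F i.+1 *m fdiff F i = 0.
Proof.
case: FI => _ _ ker; apply/row_matrixP => k; rewrite row_mul row0; apply/ker.
by exists (delta_mx 0 k); rewrite rowE.
Qed.
End Resolution.

Section ChainMaps.
Variables F F' : graded_free_seq K u.
Hypotheses (FI : free_resolution I F) (FI' : free_resolution I F').

(* Chain maps are built one degree at a time, the invariant being that the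
   current map can be lifted once more. *)
Definition liftable i (phi : 'M[R]_(frank F i, frank F' i)) :=
  exists psi, fdiff F i *m phi = psi *m fdiff F' i.

(** Surjectivity onto [R/I] lifts the augmentation of [F] through that of [F']. As [I] is
    homogeneous, the degree-0 part of the lift is still a lift. *)
Lemma chain_map_base : exists phi : 'M[R]_(frank F 0, frank F' 0),
  [/\ homogmx (@fdeg _ _ F 0) (@fdeg _ _ F' 0) phi,
      vanishes (faug F - phi *m faug F') & liftable phi].
Proof.
have [phi phiI] := resolution_aug FI' (faug F).
set e := @fdeg _ _ F 0; set d := @fdeg _ _ F' 0.
have augh : homogmx e (fun=> 0) (faug F).
  by move=> k l; rewrite ord1 subr0; apply: faug_homog.
have augh' : homogmx d (fun=> 0) (faug F').
  by move=> k l; rewrite ord1 subr0; apply: faug_homog.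
have phiI' : vanishes (faug F - hcompmx e d phi *m faug F').
  rewrite -(hcompmxM e phi augh') -[faug F](hcompmx_id augh) -hcompmxB => k l.
  by rewrite mxE; apply: I_homog; apply: phiI.
exists (hcompmx e d phi); split=> //; first exact: homogmx_hcomp.
apply: (resolution_aug_ker FI'); rewrite -mulmxA.
(* Modulo [I], the lift followed by [faug F'] is [faug F], and [fdiff F 0 *m faug F] vanishes
   there. *)
rewrite -[_ *m faug F'](subKr (faug F)) mulmxBr.
apply: vanishesD; first exact: (resolution_aug_diff FI).
by apply/vanishesN/vanishes_mulmx.
Qed.

Lemma chain_map_step i (phi : 'M[R]_(frank F i, frank F' i)) :
  homogmx (@fdeg _ _ F i) (@fdeg _ _ F' i) phi -> liftable phi ->
  exists psi : 'M[R]_(frank F i.+1, frank F' i.+1),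
  [/\ homogmx (@fdeg _ _ F i.+1) (@fdeg _ _ F' i.+1) psi,
      fdiff F i *m phi = psi *m fdiff F' i & liftable psi].
Proof.
move=> phih [psi psiE]; set e := @fdeg _ _ F i.+1; set d := @fdeg _ _ F' i.+1.
have psiE' : fdiff F i *m phi = hcompmx e d psi *m fdiff F' i.
  rewrite -(hcompmxM _ (c := @fdeg _ _ F' i)); last exact: fdiff_homog.
  rewrite -psiE (hcompmxM _ (d := @fdeg _ _ F i)) //.
  by rewrite hcompmx_id //; apply: fdiff_homog.
exists (hcompmx e d psi); split=> //; first exact: homogmx_hcomp.
apply: (resolution_ker FI').
by rewrite -mulmxA -psiE' mulmxA (resolution_diff_diff FI) mul0mx.
Qed.
End ChainMaps.

Section MinimalDegrees.
Variables F F' : graded_free_seq K u.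
Hypotheses (FI : free_resolution I F) (FI' : free_resolution I F').
Hypothesis Fmin : minimal F.

(* The homotopy between the composite F -> F' -> F and the identity is carried
   along; it is needed to continue, and minimality of F makes the composite
   invertible modulo the maximal ideal. *)
Lemma minimal_retract i : exists phi : 'M[R]_(frank F i, frank F' i),
  exists psi : 'M[R]_(frank F' i, frank F i),
  exists h : 'M[R]_(frank F i, frank F i.+1),
  [/\ homogmx (@fdeg _ _ F i) (@fdeg _ _ F' i) phi /\
      homogmx (@fdeg _ _ F' i) (@fdeg _ _ F i) psi,
      liftable phi, liftable psi,
      fdiff F i *m (phi *m psi - 1%:M - h *m fdiff F i) = 0 &
      forall k l, ((phi *m psi - 1%:M) k l)@_0%MM = 0].
Proof.
have min0 j p (Y : 'M[R]_(p, frank F j.+1)) k l : ((Y *m fdiff F j) k l)@_0%MM = 0.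
  rewrite mxE raddf_sum big1 // => s _.
  by rewrite /= rmorphM /= Fmin mulr0.
elim: i => [|i [phi [psi [h [[phih psih] phil psil hE _]]]]].
  have [phi [phih phiI phil]] := chain_map_base FI FI'.
  have [psi [psih psiI psil]] := chain_map_base FI' FI.
  have [h hE] : exists h, phi *m psi - 1%:M = h *m fdiff F 0.
    apply: (resolution_aug_ker FI).
    rewrite mulmxBl mul1mx -mulmxA -[psi *m _](subKr (faug F')) mulmxBr.
    rewrite addrAC; apply: vanishesD; last exact/vanishesN/vanishes_mulmx.
    by rewrite -opprB; apply: vanishesN.
  exists phi, psi, h; split=> //; first by rewrite hE subrr mulmx0.
  by move=> k l; rewrite hE min0.
have [phi' [phih' phiE phil']] := chain_map_step FI FI' phih phil.
have [psi' [psih' psiE psil']] := chain_map_step FI' FI psih psil.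
(* The homotopy relation one degree lower says that this difference is a cycle; exactness provides
   the next homotopy. *)
have [h' hE'] : exists h', phi' *m psi' - 1%:M - fdiff F i *m h = h' *m fdiff F i.+1.
  apply: (resolution_ker FI).
  rewrite !mulmxBl mul1mx -(mulmxA phi') -psiE mulmxA -phiE -!mulmxA.
  by move: hE; rewrite !mulmxBr mulmx1.
exists phi', psi', h'; split=> //.
  by rewrite -hE' opprB addrC subrK mulmxA (resolution_diff_diff FI) mul0mx.
move=> k l; rewrite -(subrK (fdiff F i *m h) (_ - _)) hE' mxE mcoeffD min0 add0r.
by rewrite mxE raddf_sum big1 // => s _; rewrite /= rmorphM /= Fmin mul0r.
Qed.

(** The diagonal entry of [phi *m psi] at [k] has constant term 1, so some [phi k l] has a nonzero
    constant term, which homogeneity allows only when the degrees agree. Sets of degrees, without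
    multiplicities, suffice for the regularity. *)
Lemma minimal_degrees i (k : 'I_(frank F i)) :
  exists l : 'I_(frank F' i), fdeg l = fdeg k.
Proof.
have [phi [psi [h [[phih _] _ _ _ /(_ k k)]]]] := minimal_retract i.
rewrite !mxE eqxx mcoeffB mcoeff1 eqxx => /eqP; rewrite subr_eq0 => /eqP phipsi.
have [l phikl] : exists l, (phi k l)@_0%MM != 0.
  apply/existsP; apply: contra_eqT phipsi => /existsPn phi0.
  rewrite raddf_sum big1 ?[0 == _]eq_sym ?oner_eq0 // => l _.
  by rewrite /= rmorphM /= (eqP (negbNE (phi0 l))) mul0r.
exists l; have /(phih k l) : 0%MM \in msupp (phi k l) by rewrite mcoeff_msupp.
by rewrite mdeg0 => /esym/eqP; rewrite subr_eq0 => /eqP.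
Qed.
End MinimalDegrees.

(** One minimal resolution decides: [minimal_degrees] from [F] to [F'] shows that [r] is attained,
    and from [F'] to [F] that it is not exceeded. *)
Lemma is_regularity_from (F : graded_free_seq K u) (r : int) :
  minimal_free_resolution I F ->
  (exists i (k : 'I_(frank F i)), r = fdeg k - i%:Z) ->
  (forall i (k : 'I_(frank F i)), fdeg k - i%:Z <= r) ->
  is_regularity I r.
Proof.
move=> [FI Fmin] [i0 [k0 rE]] r_max; split; first by exists F.
move=> F' [FI' Fmin'].
have bettiP (H : graded_free_seq K u) i j :
    betti H i j != 0%N <-> exists k : 'I_(frank H i), fdeg k = j.
  rewrite -lt0n; split=> [/card_gt0P[k]|[k kj]]; first by rewrite inE => /eqP; exists k.
  by apply/card_gt0P; exists k; rewrite inE kj.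
split.
  exists i0, (fdeg k0); split=> //; apply/bettiP.
  exact: (minimal_degrees FI FI').
move=> i j /bettiP[k <-]; have [l <-] := minimal_degrees FI' FI Fmin' k.
exact: r_max.
Qed.
End Comparison.

(** * Syzygies of the powers of a regular sequence *)

Section PowerSyzygies.
Variables (R : idomainType) (a b : R).
Hypotheses (a0 : a != 0) (b0 : b != 0).
Hypothesis ab_regular : forall y w k, y * b ^+ k = w * a -> exists y', y = y' * a.

(** Entry [i] of the vector [z 0, ..., z n.-1] times the Hilbert-Burch matrix. Functions on [nat]
    replace vectors so that an induction can change [n]. *)
Definition syzygy n (z : nat -> R) (i : nat) : R :=
  (if (i < n)%N then z i * b else 0) - (if (0 < i)%N then z i.-1 * a else 0).

(** Induction on [n]: every term but the last is a multiple of [a], so regularity gives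
    [y n.+1 = w * a]. Moving [w * b] into the coefficient [y n] and cancelling [a] leaves a relation
    of length [n]. *)
Lemma power_syzygies n (y : nat -> R) :
  \sum_(i < n.+1) y i * (a ^+ (n - i) * b ^+ i) = 0 ->
  exists z, forall i, (i <= n)%N -> y i = syzygy n z i.
Proof.
elim: n y => [|n IHn] y.
  rewrite big_ord1 mulr1 mulr1 => y0; exists (fun=> 0) => i.
  by rewrite leqn0 => /eqP->; rewrite /syzygy /= subrr.
rewrite big_ord_recr /= subnn mul1r => sum0.
pose s := \sum_(i < n.+1) y i * (a ^+ (n - i) * b ^+ i).
have sE : \sum_(i < n.+1) y i * (a ^+ (n.+1 - i) * b ^+ i) = s * a.
  rewrite mulr_suml; apply: eq_bigr => i _.
  by rewrite subSn -1?ltnS // exprSr; ring.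
rewrite sE in sum0.
have [w wE] : exists w, y n.+1 = w * a.
  apply: (ab_regular (w := - s) (k := n.+1)).
  by rewrite mulNr; apply/eqP; rewrite -addr_eq0 addrC sum0.
pose y' i := if i == n then y n + w * b else y i.
have [|z' z'E] := IHn y'.
  apply: (mulIf a0); rewrite mul0r; apply: etrans sum0; rewrite /s !big_ord_recr /= wE /y' eqxx.
  rewrite (eq_bigr (fun i : 'I_n => y i * (a ^+ (n - i) * b ^+ i))).
    by rewrite subnn exprS; ring.
  by move=> i _; rewrite ltn_eqF.
(* The new value [- w] at [n] is forced by the last entry, [- z n * a = w * a]; at entry [n] it
   undoes the correction in [y']. *)
exists (fun i => if i == n then - w else z' i) => i.
rewrite leq_eqVlt => /predU1P[->|]; rewrite /syzygy.
  by rewrite ltnn /= eqxx wE; ring.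
rewrite ltnS => le_in; rewrite le_in.
have := z'E i le_in; rewrite /y' /syzygy.
have [->|ne_in] := eqVneq i n.
  rewrite ltnn sub0r => /(canRL (addrK _))->.
  by case: (n) => [|k] /=; rewrite ?ltn_eqF //; ring.
have lt_in : (i < n)%N by rewrite ltn_neqAle ne_in.
rewrite lt_in => ->; case: i lt_in {ne_in le_in} => [|i] lt_in //=.
by rewrite ltn_eqF // ltnW.
Qed.

Lemma sum_syzygy n z : \sum_(i < n.+1) syzygy n z i * (a ^+ (n - i) * b ^+ i) = 0.
Proof.
rewrite /syzygy; under eq_bigr do rewrite mulrBl.
rewrite sumrB big_ord_recr /= ltnn mul0r addr0 big_ord_recl /= mul0r add0r.
apply/eqP; rewrite subr_eq0; apply/eqP/eq_bigr => i _.
by rewrite ltn_ord -(subnSK (ltn_ord i)) !exprS; ring.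
Qed.

(** The matrix is triangular with [b] on the diagonal, so the [z i] vanish one after another from
    [i = 0]. *)
Lemma syzygy_inj n (z : nat -> R) :
  (forall i, (i <= n)%N -> syzygy n z i = 0) -> forall i, (i < n)%N -> z i = 0.
Proof.
move=> z0; elim=> [|i IHi] lt_in; have := z0 _ (ltnW lt_in); rewrite /syzygy lt_in.
  by rewrite subr0 => /eqP; rewrite mulf_eq0 (negPf b0) orbF => /eqP.
rewrite /= IHi ?mul0r ?subr0 1?ltnW // => /eqP.
by rewrite mulf_eq0 (negPf b0) orbF => /eqP.
Qed.
End PowerSyzygies.

Section InDegree.
Variables (K : fieldType) (u : nat).

Lemma in_degree0 z : in_degree z (0 : {mpoly K[u]}).
Proof. by move=> m; rewrite msupp0. Qed.

Lemma in_degreeN z (f : {mpoly K[u]}) : in_degree z f -> in_degree z (- f).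
Proof. by move=> fz m; rewrite (perm_mem (msuppN f)); apply: fz. Qed.

Lemma in_degreeX z (m : 'X_{1..u}) :
  (mdeg m)%:Z = z -> in_degree z ('X_[m] : {mpoly K[u]}).
Proof. by move=> mz k; rewrite msuppX inE => /eqP->. Qed.
End InDegree.

(** * The Hilbert-Burch resolution *)

Section HilbertBurch.
Variables (K : fieldType) (u : nat) (V1 V2 : {set 'I_u}) (n : nat).
Hypotheses (V1n0 : V1 != set0) (V2n0 : V2 != set0) (V12 : [disjoint V1 & V2]).
Hypothesis n_gt0 : (0 < n)%N.
Local Notation R := {mpoly K[u]}.
Local Notation A := (mesym1 V1).
Local Notation B := (mesym1 V2).
Local Notation a := ('X_[A] : R).
Local Notation b := ('X_[B] : R).
Local Notation p1 := #|V1|.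
Local Notation p2 := #|V2|.

Definition hb_gen (i : nat) : R := 'X_[A *+ (n - i) + B *+ i].

Lemma hb_genE i : hb_gen i = a ^+ (n - i) * b ^+ i.
Proof. by rewrite /hb_gen mpolyXD !mpolyXn. Qed.

Definition hb_rank (i : nat) : nat :=
  match i with 0 => 1 | 1 => n.+1 | 2 => n | _ => 0 end%N.

(** In homological degree 2, the relation between generators [k] and [k.+1] has the degree of their
    least common multiple [a^(n-k) b^(k+1)]. *)
Definition hb_deg (i : nat) : 'I_(hb_rank i) -> int :=
  match i return 'I_(hb_rank i) -> int with
  | 1 => fun k => ((n - k) * p1 + k * p2)%N%:Z
  | 2 => fun k => ((n - k) * p1 + k.+1 * p2)%N%:Z
  | _ => fun=> 0
  end.

(** Up to sign, the maximal minors of this matrix are the generators [a^(n-i) b^i]. *)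
Definition hb_syzygies : 'M[R]_(n, n.+1) :=
  \matrix_(k, l) (if l == k :> nat then b else if l == k.+1 :> nat then - a else 0).

Definition hb_diff (i : nat) : 'M[R]_(hb_rank i.+1, hb_rank i) :=
  match i return 'M[R]_(hb_rank i.+1, hb_rank i) with
  | 0 => \col_(k < n.+1) hb_gen k
  | 1 => hb_syzygies
  | _ => 0
  end.

Lemma hb_diff_homog i k l : in_degree (hb_deg k - hb_deg l) (hb_diff i k l).
Proof.
case: i k l => [|[|[|i]]] k l; rewrite /= ?mxE; last exact: in_degree0.
- by apply: in_degreeX; rewrite mdegD !mdegMn !mdeg_mesym1 subr0 mulnC [(_ * k)%N]mulnC.
- have ltk := ltn_ord k; case: eqP => [->|_].
    by apply: in_degreeX; rewrite mdeg_mesym1 mulSn !PoszD; ring.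
  case: eqP => [->|_]; last exact: in_degree0.
  by apply/in_degreeN/in_degreeX; rewrite mdeg_mesym1 -(subnSK ltk) mulSn !PoszD; ring.
- by case: (k).
Qed.

Lemma hb_aug_homog (k : 'I_(hb_rank 0)) : in_degree (hb_deg k) ((1%:M : 'cV[R]_1) k 0).
Proof. by rewrite /= !mxE ord1 -mpolyX0; apply: in_degreeX; rewrite mdeg0. Qed.

Definition hilbert_burch : graded_free_seq K u :=
  @GradedFreeSeq K u hb_rank hb_deg hb_diff 1%:M hb_diff_homog hb_aug_homog.

Lemma mesym1_neq0 (S : {set 'I_u}) : S != set0 -> mesym1 S != 0%MM.
Proof. by move=> S0; rewrite -mdeg_eq0 mdeg_mesym1 cards_eq0. Qed.

Lemma hilbert_burch_minimal : minimal hilbert_burch.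
Proof.
have X0 (m : 'X_{1..u}) : m != 0%MM -> ('X_[m] : R)@_0%MM = 0.
  by move=> /negPf m0; rewrite mcoeffX m0.
move=> [|[|[|i]]] k l; rewrite /= ?mxE ?mcoeff0 //.
- rewrite X0 // mnmD_eq0 -!mdeg_eq0 !mdegMn !mdeg_mesym1 !muln_eq0 !cards_eq0.
  by rewrite (negPf V1n0) (negPf V2n0) /=; case: (k : nat) => [|j]; rewrite ?subn0; lia.
- case: ifP => _; first by rewrite X0 // mesym1_neq0.
  by case: ifP => _; rewrite ?mcoeff0 // mcoeffN X0 ?oppr0 // mesym1_neq0.
Qed.

Lemma mulmx_hb_syzygies (z : nat -> R) (l : 'I_n.+1) :
  ((\row_(k < n) z k) *m hb_syzygies) 0 l = syzygy a b n z l.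
Proof.
rewrite mxE /syzygy.
rewrite (eq_bigr (fun k : 'I_n => (if k == l :> nat then z k * b else 0) -
     (if k.+1 == l :> nat then z k * a else 0))); last first.
  move=> k _; rewrite !mxE eq_sym [X in if X then - a else _]eq_sym.
  have [->|_] := eqVneq (k : nat) l.
    by rewrite eqn_leq ltnn andFb subr0.
  by case: ifP => _; rewrite ?sub0r ?mulrN ?oppr0 ?mulr0.
rewrite sumrB -!big_mkcond /=; congr (_ - _).
  case: ltnP => ln.
    by rewrite (big_pred1 (Ordinal ln)) // => k; rewrite -val_eqE.
  by rewrite big_pred0 // => k; rewrite ltn_eqF // (leq_trans _ ln).
case: l => -[|l] lt_l /=; first by rewrite big_pred0.
by rewrite (big_pred1 (Ordinal (lt_l : (l < n)%N))) // => k; rewrite -val_eqE eqSS.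
Qed.

Lemma rowE_nat p (x : 'rV[R]_p) : exists y : nat -> R, x = \row_(k < p) y k.
Proof.
case: p x => [|p] x; first by exists (fun=> 0); apply/rowP => -[].
by exists (fun k => x 0 (inord k)); apply/rowP => k; rewrite mxE inord_val.
Qed.

(** [A] and [B] have disjoint supports: a monomial of [y] times [b ^+ k] is divisible by [a], and
    the factor [b ^+ k] contributes no variable of [V1]. *)
Lemma hb_regular (y w : R) k : y * b ^+ k = w * a -> exists y', y = y' * a.
Proof.
move=> yE; apply: mpolyX_dvd => m my; apply/mnm_lepP => i; rewrite mnmE.
case: (boolP (i \in V1)) => // iV.
have : (B *+ k + m)%MM \in msupp (y * b ^+ k).
  by rewrite mpolyXn (perm_mem (msuppMX _ _)) map_f.
rewrite yE (perm_mem (msuppMX _ _)) => /mapP[m' _ /mnmP/(_ i)].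
by rewrite !mnmDE mulmnE !mnmE iV (disjointFr V12 iV) mul0n; lia.
Qed.

Lemma monomial_ideal_gens (f : R) :
  f \in monomial_ideal (cover_monomial V1 V2 n) ->
  exists y : 'rV_n.+1, f = \sum_i y 0 i * hb_gen i.
Proof.
move=> /monomial_idealP Cf.
rewrite [f]mpolyE big_seq; elim/big_rec: _ => [|m f' /Cf/(cover_monomial_dvd V12)[i le_m] [y ->]].
  by exists 0; rewrite big1 // => i _; rewrite mxE mul0r.
exists (y + (f@_m *: 'X_[m - (A *+ (n - i) + B *+ i)]) *: delta_mx 0 i).
under [RHS]eq_bigr do rewrite !mxE mulrDl.
rewrite big_split /= addrC; congr (_ + _); rewrite (bigD1 i) //= eqxx mulr1.
rewrite big1 ?addr0 => [|j /negPf->]; last by rewrite mulr0 mul0r.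
by rewrite -scalerAl -mpolyXD submK.
Qed.

Lemma hilbert_burch_resolution (I : {pred R}) :
  I =i monomial_ideal (cover_monomial V1 V2 n) -> free_resolution I hilbert_burch.
Proof.
move=> IE.
have X0 (m : 'X_{1..u}) : 'X_[m] != 0 :> R.
  by rewrite -msupp_eq0 msuppX.
split.
- move=> f; exists (f%:M : 'M_1); rewrite mulmx1 mxE eqxx subrr IE.
  exact: monomial_ideal0.
- move=> x /=; rewrite mulmx1 IE; split=> [|[y ->]].
    case/monomial_ideal_gens=> y xE; exists y; apply/rowP => k.
    by rewrite ord1 xE !mxE; apply: eq_bigr => i _; rewrite mxE.
  rewrite mxE; apply: monomial_ideal_sum => i _; rewrite mxE.
  apply: (@monomial_idealM _ _ _ predT (cover_monomial V1 V2 n)).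
  + by move=> *; apply: cover_monomial_up.
  + exact/allP.
  + by rewrite monomial_idealX; apply: cover_monomial_gens; rewrite // -ltnS.
(* In reverse order: the zero modules from homological degree 3 on, injectivity of the syzygy
   matrix, and exactness at the generators by [power_syzygies]. *)
- move=> [|[|i]] x /=; last first.
  + split=> _; last by rewrite mulmx0.
    by exists 0; rewrite mul0mx; apply: thinmx0.
  + split=> [x0|[y ->]]; last by rewrite mulmx0 mul0mx.
    exists 0; rewrite mul0mx; have [z xE] := rowE_nat x.
    have z0 := @syzygy_inj _ a b (X0 _) n z _.
    apply/rowP => k; rewrite mxE xE mxE z0 // => i le_in.
    rewrite -[i]/(nat_of_ord (Ordinal (le_in : (i < n.+1)%N))) -mulmx_hb_syzygies -xE.
    by rewrite x0 mxE.
  + split=> [x0|[y ->]].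
      have [y xE] := rowE_nat x.
      have [|z yE] := @power_syzygies _ a b (X0 _) hb_regular n y.
        move/rowP/(_ 0): x0; rewrite !mxE => x0; apply: etrans x0; apply: eq_bigr => i _.
        by rewrite xE !mxE hb_genE.
      exists (\row_k z k); apply/rowP => l.
      by rewrite mulmx_hb_syzygies xE mxE yE // -ltnS.
    have [z ->] := rowE_nat y; apply/rowP => k; rewrite !mxE.
    under eq_bigr => l _ do rewrite mulmx_hb_syzygies mxE hb_genE.
    exact: sum_syzygy.
Qed.
End HilbertBurch.

(** * Regularity of the powers *)

Lemma hb_deg_le (n p1 p2 : nat) : (0 < n)%N -> (0 < p1)%N -> (p1 <= p2)%N ->
  let r := (p1 + n * p2)%N%:Z - 2 in
  [/\ 0 <= r,
      forall k, (k <= n)%N -> ((n - k) * p1 + k * p2)%N%:Z - 1 <= r &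
      forall k, (k < n)%N -> ((n - k) * p1 + k.+1 * p2)%N%:Z - 2 <= r].
Proof.
move=> n_gt0 p1_gt0 le_p r.
(* As [p1 <= p2], trading factors [a] for [b] never lowers the degree, so [b^n] is a generator of
   top degree. *)
have le_np2 k : (k <= n)%N -> ((n - k) * p1 + k * p2 <= n * p2)%N.
  move=> le_kn; rewrite -[X in (_ <= X * _)%N](subnK le_kn) mulnDl leq_add2r.
  by rewrite leq_mul2l le_p orbT.
have np2_gt0 : (0 < n * p2)%N by rewrite muln_gt0 n_gt0 (leq_trans p1_gt0).
rewrite /r; split=> [|k /le_np2|k lt_kn]; [by lia | by lia |].
(* The degree of relation [k] is [p1] plus that of generator [k.+1]. *)
have := le_np2 k.+1 lt_kn; rewrite -(subnSK lt_kn) [(_.+1 * p1)%N]mulSn; lia.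
Qed.

Section Regularity.
Variables (K : fieldType) (u : nat) (G : sgraph u) (V1 V2 : {set 'I_u}).
Hypothesis HG : complete_bipartite G V1 V2.
Local Notation J := (cover_ideal K G).

Lemma cover_regularity n : (0 < n)%N -> (#|V1| <= #|V2|)%N ->
  is_regularity (ideal_exp J n) ((#|V1| + n * #|V2|)%N%:Z - 2).
Proof.
case: (HG) => V1n0 V2n0 _ V12 _ n_gt0 leV.
have IE := @mem_cover_ideal_exp _ _ _ V12 K _ HG n.
have V1_gt0 : (0 < #|V1|)%N by rewrite card_gt0.
apply: (@is_regularity_from _ _ _ _ _ _ (hilbert_burch K V1 V2 n)).
- by rewrite IE; apply: monomial_ideal0.
- move=> a f g; rewrite !IE; apply: monomial_ideal_lin.
  by move=> *; apply: cover_monomial_up.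
- move=> z f; rewrite !IE => /monomial_idealP Cf; apply/monomial_idealP => m.
  rewrite mcoeff_msupp mcoeff_hcomp; case: ifP => _; last by rewrite eqxx.
  by rewrite -mcoeff_msupp => /Cf.
- split; first exact: hilbert_burch_resolution.
  exact: hilbert_burch_minimal.
(* The maximum is attained by the last relation, of degree [p1 + n p2] in homological degree 2. *)
- case: n n_gt0 {IE} => // n _; exists 2, (ord_max : 'I_n.+1).
  by rewrite /= subSnn mul1n.
- have [deg0 deg1 deg2] := hb_deg_le n_gt0 V1_gt0 leV.
  move=> [|[|[|i]]] k.
  + by rewrite subr0.
  + exact: deg1 (ltnSE (ltn_ord k)).
  + exact: deg2 (ltn_ord k).
  + by case: k.
Qed.
End Regularity.

Theorem theorem4p1 (K : fieldType) (u p1 p2 : nat) (G : sgraph u)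
    (V1 V2 : {set 'I_u}) (HG : complete_bipartite G V1 V2)
    (HV1 : #|V1| = p1) (HV2 : #|V2| = p2) (Hp : (p1 <= p2)%N) :
  let J := cover_ideal K G in
  [/\ (forall n : nat, (1 <= n)%N ->
         is_v_number (ideal_exp J n) (n * p1 + p2 - 2)%N),
      (forall n : nat, (1 <= n)%N ->
         exists (r : int) (v : nat),
           [/\ is_regularity (ideal_exp J n) r, is_v_number (ideal_exp J n) v &
               r - v%:Z = n%:Z * (p2%:Z - p1%:Z) - (p2%:Z - p1%:Z)])
      /\ (exists v : nat, is_v_number J v /\ is_regularity J v%:Z),
      (p2 = p1 ->
       forall n : nat, (1 <= n)%N ->
         exists v : nat, is_regularity (ideal_exp J n) v%:Z
                         /\ is_v_number (ideal_exp J n) v) &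
      (p2 = (p1 + 1)%N ->
       forall n : nat, (1 <= n)%N ->
         exists (r : int) (v : nat),
           [/\ is_regularity (ideal_exp J n) r, is_v_number (ideal_exp J n) v &
               r - v%:Z = n%:Z - 1])].
Proof.
move=> J.
have p1_gt0 : (0 < p1)%N by case: HG => V1n0 *; rewrite -HV1 card_gt0.
have v_num n : (1 <= n)%N -> is_v_number (ideal_exp J n) (n * p1 + p2 - 2)%N.
  by move=> n_gt0; rewrite -HV1 -HV2; apply: cover_v_number => //; rewrite HV1 HV2.
have reg n : (1 <= n)%N -> is_regularity (ideal_exp J n) ((p1 + n * p2)%N%:Z - 2).
  by move=> n_gt0; rewrite -HV1 -HV2; apply: cover_regularity => //; rewrite HV1 HV2.
have diff n : (1 <= n)%N -> (p1 + n * p2)%N%:Z - 2 - (n * p1 + p2 - 2)%N%:Z =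
    n%:Z * (p2%:Z - p1%:Z) - (p2%:Z - p1%:Z).
  (* The truncated subtraction is a true one because [n * p1 + p2 >= 2]. *)
  move=> n_gt0; rewrite -subzn ?PoszD ?PoszM; last by nia.
  ring.
(* Serves both cases in which the difference vanishes, [n = 1] and [p1 = p2]. *)
have reg_v n : (1 <= n)%N -> n%:Z * (p2%:Z - p1%:Z) = p2%:Z - p1%:Z ->
    is_regularity (ideal_exp J n) (n * p1 + p2 - 2)%N%:Z.
  move=> n_gt0 e; have := diff n n_gt0; rewrite e subrr => /eqP.
  by rewrite subr_eq0 => /eqP <-; apply: reg.
(* By definition [ideal_exp J 1] is the product of [J] with the whole ring; both sides are the same
   monomial ideal. *)
have J1 : ideal_exp J 1 = J.
  apply/funext => f; have [_ _ _ V12 _] := HG.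
  by rewrite -[LHS]/(f \in ideal_exp J 1) (mem_cover_ideal_exp V12 HG) -(mem_cover_ideal HG).
split=> //.
- split=> [n n_gt0|].
    by exists ((p1 + n * p2)%N%:Z - 2), (n * p1 + p2 - 2)%N; split; auto.
  exists (1 * p1 + p2 - 2)%N; rewrite -{1 2}J1; split; first exact: v_num.
  by apply: reg_v => //; rewrite mul1r.
- move=> p12 n n_gt0; exists (n * p1 + p2 - 2)%N; split; last exact: v_num.
  by apply: reg_v => //; rewrite p12 subrr mulr0.
- move=> p12 n n_gt0; exists ((p1 + n * p2)%N%:Z - 2), (n * p1 + p2 - 2)%N.
  split; [exact: reg | exact: v_num | rewrite diff // p12 PoszD; ring].
Qed.
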